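(* Assume $2^{<\mathfrak{c}} = \mathfrak{c}$. Let $X$ be a regular Hausdorff space such that $\hat{s}(X) \cdot b(X) \leq \mathfrak{c}$. Then $|X| \leq \mathfrak{c}$.
   Context: All spaces are Hausdorff. $\mathfrak{c} = 2^{\aleph_0}$ and $2^{<\mathfrak{c}} = \sup\{2^\lambda : \lambda < \mathfrak{c}\}$. A subset of $X$ is discrete if its subspace topology is discrete (it need not be closed). $\hat{s}(X) = \min\{\kappa : \text{if } A \subset X \text{ and } |A| = \kappa \text{ then } A \text{ is not a discrete set}\}$. A sequence $\{x_\alpha : \alpha < \kappa\}$ of points of $X$ ($\kappa$ an ordinal) is free if for every $\gamma < \kappa$ we have $\overline{\{x_\alpha : \alpha \leq \gamma\}} \cap \overline{\{x_\alpha : \alpha > \gamma\}} = \emptyset$; a subset of $X$ is called a free sequence if it can be enumerated as one. $b(X) = \sup\{|\overline{F}| : F \subset X \text{ is a free sequence}\}$. *)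

(* Defs.v *)
From mathcomp Require Import all_boot.
From mathcomp Require Import all_classical.
From mathcomp Require Import topology.

Set Implicit Arguments.
Unset Strict Implicit.
Unset Printing Implicit Defensive.

Local Open Scope classical_set_scope.
Local Open Scope card_scope.

(* A cardinal number is represented by any type having that cardinality;
   cardinals are compared with [#<=] and [#=] on full sets. Thus [set K]
   represents 2^|K| and [(K * L)%type] represents the product |K||L|. *)

Definition card_lt (K L : Type) : Prop :=
  ([set: K] #<= [set: L]) /\ ~ ([set: L] #<= [set: K]).

Definition is_card_min (P : Type -> Prop) (K : Type) : Prop :=
  P K /\ forall L : Type, P L -> [set: K] #<= [set: L].

(* Well defined up to equipotence; by [card_minP] below, the default value is
   only reached when P holds of no type. *)
Definition card_min (P : Type -> Prop) : Type :=
  if pselect (exists K, is_card_min P K) is left h then projT1 (cid h) else void.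

Definition card_sup (I : Type) (D : set I) (K : I -> Type) : Type :=
  card_min (fun M : Type => forall i, D i -> [set: K i] #<= [set: M]).

Lemma card_leT_inj (K L : Type) :
  ([set: K] #<= [set: L]) <-> exists f : K -> L, injective f.
Proof.
split=> [/card_leP[f]|[f finj]].
  exists (fun a => set_val (f (SigSub (mem_set (I : [set: K] a))))).
  move=> a b /val_inj /(@inj _ _ _ f); rewrite !in_setT => /(_ isT isT).
  by move=> /(congr1 val).
have /injfunPex[g] : exists2 g, set_fun [set: K] [set: L] g & set_inj setT g;
  last exact: inj_card_le g.
by exists f => // x y _ _; exact: finj.
Qed.

(* A nonempty family of cardinals has a least element (Hoenig's argument). *)
Lemma card_le_family_min (I : Type) (K : I -> Type) (i0 : I) :
  exists i, forall j, [set: K i] #<= [set: K j].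
Proof.
pose sep (S : set (forall i, K i)) :=
  forall f g, S f -> S g -> forall i, f i = g i -> f = g.
have [F sepF totF|S [sepS maxS]] := @Zorn_bigcup _ sep.
  move=> f g [A FA Af] [B FB Bg] i.
  by have [AB|BA] := totF _ _ FA FB;
    [apply: (sepF _ FB) => //; exact: AB|apply: (sepF _ FA) => //; exact: BA].
have [[i Si]|nS] := pselect (exists i, forall a : K i, exists f, S f /\ f i = a).
  have /choice[h hP] := Si.
  exists i => j; apply/card_leT_inj; exists (fun a => h a j) => a b hab.
  have [Sa ha] := hP a; have [Sb hb] := hP b.
  by rewrite -ha -hb (sepS _ _ Sa Sb j hab).
have ex i : exists a : K i, forall f, S f -> f i <> a.
  apply: contrapT => nex; apply: nS; exists i => a.
  apply: contrapT => na; apply: nex; exists a => f Sf fa.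
  by apply: na; exists f.
pose g i := projT1 (cid (ex i)).
have gP i f : S f -> f i <> g i by exact: (projT2 (cid (ex i))).
exfalso; apply: (maxS (S `|` [set g])).
  split; first exact: subsetUl.
  by move=> /(_ g (or_intror erefl)) Sg; exact: (gP i0 g).
move=> f1 f2 [S1|->] [S2|->] i // e; first exact: (sepS _ _ S1 S2 i).
  by have := gP i _ S1.
by have := gP i _ S2; rewrite e.
Qed.

Lemma card_le_total (K L : Type) :
  ([set: K] #<= [set: L]) \/ ([set: L] #<= [set: K]).
Proof.
have [[] h] := card_le_family_min (fun b : bool => if b then K else L) true.
  by left; exact: (h false).
by right; exact: (h true).
Qed.

Lemma card_minP (P : Type -> Prop) :
  (exists K, P K) -> is_card_min P (card_min P).
Proof.
move=> [K0 PK0]; rewrite /card_min; case: pselect => [h|nh].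
  exact: (projT2 (cid h)).
exfalso; apply: nh.
pose J := {A : set K0 | exists L, P L /\ (A #= [set: L])}.
have J0 : J by exists [set: K0]; exists K0; rewrite card_eqxx.
have [[A [L [PL AL]]] minA] := card_le_family_min (fun B : J => projT1 B) J0.
exists L; split=> // M PM.
have LK0 : [set: L] #<= [set: K0].
  by rewrite -(card_le_eql AL) card_leT.
have [K0M|MK0] := card_le_total K0 M; first exact: card_le_trans LK0 K0M.
have /card_leT_inj[f finj] := MK0.
have fM : range f #= [set: M] by apply: inj_card_eq; exact: in2W.
have := minA (exist _ (range f) (ex_intro _ M (conj PM fM))).
rewrite (card_le_eql (card_setT _)) (card_le_eqr (card_setT _)) /=.
by rewrite (card_le_eql AL) (card_le_eqr fM).
Qed.

Lemma card_supP (I : Type) (D : set I) (K : I -> Type) :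
  (exists M : Type, forall i, D i -> [set: K i] #<= [set: M]) ->
  (forall i, D i -> [set: K i] #<= [set: card_sup D K]) /\
  (forall M : Type, (forall i, D i -> [set: K i] #<= [set: M]) ->
    [set: card_sup D K] #<= [set: M]).
Proof. exact: card_minP. Qed.

(* 2^{<K} *)
Definition card_exp_lt (K : Type) : Type :=
  card_sup [set L : Type | card_lt L K] (fun L => set L).

(* 2^{aleph_0} *)
Definition continuum : Type := set nat.

(* [set_type A] carries the subspace topology induced by [X]. *)
Definition discrete_subset (X : topologicalType) (A : set X) : Prop :=
  forall U : set (set_type A), open U.

Definition s_hat (X : topologicalType) : Type :=
  card_min (fun K : Type =>
    forall A : set X, A #= [set: K] -> ~ discrete_subset A).

(* The index set of the sequence is an ordinal, given as a type I with a
   (reflexive) well-order R; [~~ R a g] means that a is above g. *)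
Definition free_enumeration (X : topologicalType) (I : Type) (R : rel I)
    (x : I -> X) : Prop :=
  wochoice.well_order R /\
  forall g : I, closure (x @` [set a | R a g]) `&`
                closure (x @` [set a | ~~ R a g]) = set0.

Definition free_sequence (X : topologicalType) (F : set X) : Prop :=
  exists (I : Type) (R : rel I) (x : I -> X),
    free_enumeration R x /\ range x = F.

Definition b_card (X : topologicalType) : Type :=
  card_sup [set F : set X | free_sequence F]
           (fun F => set_type (closure F)).

Lemma card_exp_ltP (K : Type) :
  (forall L : Type, card_lt L K -> [set: set L] #<= [set: card_exp_lt K]) /\
  (forall M : Type, (forall L : Type, card_lt L K -> [set: set L] #<= [set: M]) ->
    [set: card_exp_lt K] #<= [set: M]).
Proof.
apply: card_supP; exists (set K) => L [/card_leT_inj[f finj] _].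
apply/card_leT_inj; exists (fun A : set L => f @` A).
move=> A B /seteqP[AB BA]; apply/seteqP; split=> x Ax.
  by have [y By /finj <-] := AB (f x) (ex_intro2 _ _ x Ax erefl).
by have [y Ay /finj <-] := BA (f x) (ex_intro2 _ _ x Ax erefl).
Qed.

Lemma s_hatP (X : topologicalType) :
  (forall A : set X, A #= [set: s_hat X] -> ~ discrete_subset A) /\
  (forall K : Type, (forall A : set X, A #= [set: K] -> ~ discrete_subset A) ->
    [set: s_hat X] #<= [set: K]).
Proof.
apply: card_minP; exists (set X) => A AX.
have : [set: set X] #<= [set: X].
  by rewrite -(card_le_eql AX) card_leT.
move=> /card_leT_inj[f finj] _.
pose D : set X := [set y | exists2 B, f B = y & ~ B y].
have [Df|nDf] := pselect (D (f D)); last by apply: (nDf); exists D.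
by case: (Df) => B /finj ->; apply.
Qed.

Lemma b_cardP (X : topologicalType) :
  (forall F : set X, free_sequence F -> closure F #<= [set: b_card X]) /\
  (forall M : Type, (forall F : set X, free_sequence F -> closure F #<= [set: M]) ->
    [set: b_card X] #<= [set: M]).
Proof.
have bnd : exists M : Type, forall F : set X, free_sequence F ->
    [set: set_type (closure F)] #<= [set: M].
  by exists X => F _; rewrite (card_le_eql (card_setT _)) card_leT.
have [ub lub] := @card_supP _ [set F : set X | free_sequence F] _ bnd.
split=> [F /ub|M h]; first by rewrite (card_le_eql (card_setT _)).
by apply: lub => F /h; rewrite (card_le_eql (card_setT _)).
Qed.

(* Main.v *)
Require Import Defs.
From mathcomp Require Import all_boot.
From mathcomp Require Import all_classical.
From mathcomp Require Import topology.

Local Open Scope classical_set_scope.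
Local Open Scope card_scope.

(** Every point [p] of [X] is caught in the closure of a free sequence of length
    less than the continuum [c], built from few data.

    The bound on discrete sets, [2^{<c} = c] and regularity give that every
    closed set is an intersection of [c] open sets ([closure_pseudocharacter]), so that
    one can fix for each [A] open sets [W A k], [k < c], around [closure A]
    which together exclude every point outside [closure A].  Given [p], define
    [x p a] by transfinite recursion along a well-order of [c]: as long as [p]
    is outside the closure of [x p b], [b < a], pick [k] such that
    [W {x p b | b < a} k] misses [p]; the next point is chosen, in a way that
    does not look at [p], outside all the open sets picked up to and including
    this one, which is possible because [p] itself lies there.  The points
    obtained so far form a free sequence and a discrete set
    ([separated_segment]): each open set contains the closure of an initial
    segment and misses all later points.  A discrete set has fewer than [c]
    points, so the recursion stops at some [a], where [p] falls into the
    closure of [x p b], [b < a], a set of size at most [c] by the bound on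
    closures of free sequences.

    The sequence stopped at [a] is determined by [a] and by the indices [k]
    picked before [a], a function from a set of size less than [c] to [c].
    By [2^{<c} = c] there are only [c] such functions ([fun_to_continuum]),
    hence [X] is covered by [c] sets of size at most [c]. *)

(** * Cardinal arithmetic of the continuum *)

Lemma image_injective (S T : Type) (f : S -> T) :
  injective f -> injective (fun A : set S => f @` A).
Proof.
move=> finj A B /seteqP[AB BA]; apply/seteqP; split=> x Ax.
  by have [y By /finj <-] := AB (f x) (ex_intro2 _ _ x Ax erefl).
by have [y Ay /finj <-] := BA (f x) (ex_intro2 _ _ x Ax erefl).
Qed.

Lemma card_le_set_inj (T K : Type) (k0 : K) (A : set T) :
  A #<= [set: K] -> exists f : T -> K, set_inj A f.
Proof.
rewrite -(card_le_eql (card_setT _)) => /card_leT_inj[f finj].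
exists (fun x => if pselect (A x) is left Ax then f (SigSub (mem_set Ax)) else k0).
move=> x y /set_mem Ax /set_mem Ay.
case: pselect => // Ax'; case: pselect => // Ay'.
by move=> /finj /(congr1 val).
Qed.

Lemma card_lt_eql (S T K : Type) (A : set S) (B : set T) :
  A #= B -> card_lt (set_type A) K -> card_lt (set_type B) K.
Proof.
move=> AB [AK nKA]; split.
  by rewrite (card_le_eql (card_setT _)) -(card_le_eql AB)
    -(card_le_eql (card_setT _)).
by rewrite (card_le_eqr (card_setT _)) -(card_le_eqr AB)
  -(card_le_eqr (card_setT _)).
Qed.

Lemma continuum_pairing :
  exists f : continuum * continuum -> continuum, injective f.
Proof.
pose tag (AB : continuum * continuum) : set (nat + nat) :=
  [set s | match s with inl n => AB.1 n | inr n => AB.2 n end].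
exists (fun AB => pickle @` tag AB) => -[A B] [A' B'] /=.
move=> /(image_injective _ _ _ (pcan_inj pickleK)) e.
congr pair; apply/funext => n.
  exact: (congr1 (fun s : set (nat + nat) => s (inl n)) e).
exact: (congr1 (fun s : set (nat + nat) => s (inr n)) e).
Qed.

(** Koenig's diagonal argument for the uncountable cofinality of [c]: cut each
    subset of [nat] into countably many rows, so that an injection into
    [L * nat] exhibits [c^nat] as a union of countably many sets of size at
    most [L]; the [n]-th of them does not realise every possible [n]-th row,
    and a sequence of missed rows is missed by the union. *)
Lemma not_continuum_le_mul_nat (L : Type) :
  card_lt L continuum -> ~ ([set: continuum] #<= [set: (L * nat)%type]).
Proof.
move=> [_ nCL] /card_leT_inj[j jinj].
pose row (n : nat) (A : continuum) : continuum :=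
  [set m : nat | A (pickle (n, m))].
have /choice[y yP] : forall n, exists y, forall A, (j A).2 = n -> row n A <> y.
  move=> n; apply: contrapT => nex; apply: nCL; apply/card_leT_inj.
  have /choice[A AP] : forall y, exists A, (j A).2 = n /\ row n A = y.
    move=> y.
    apply: contrapT => nA; apply: nex.
    by exists y => A jA rA; apply: nA; exists A.
  exists (fun y => (j (A y)).1) => y z e.
  have [ny ry] := AP y; have [nz rz] := AP z.
  rewrite -ry -rz; congr row; apply: jinj.
  by rewrite [LHS]surjective_pairing [RHS]surjective_pairing e ny nz.
pose D : continuum := [set k | exists n m, k = pickle (n, m) /\ y n m].
apply: (yP _ D erefl); apply/funext => m; apply/propext; split; last first.
  by move=> ym; exists (j D).2, m.
by move=> [n' [m' [/(pcan_inj pickleK)[-> ->]]]].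
Qed.

Lemma card_lt_mul_nat (L : Type) :
  card_lt L continuum -> card_lt (L * nat)%type continuum.
Proof.
move=> Lc; split; last exact: not_continuum_le_mul_nat.
have [/card_leT_inj[f finj] _] := Lc.
have [p pinj] := continuum_pairing.
apply/card_leT_inj; exists (fun ln => p (f ln.1, [set ln.2])).
move=> [l n] [l' n'] /pinj[/finj -> e] /=; congr pair.
by have : [set n'] n by rewrite -e.
Qed.

(** The supremum defining [card_exp_lt] ranges over the types of one universe,
    which need not contain the carrier of a given space nor any instance of
    [set_type].  A cardinal below [c] is also that of a subset of
    [nat -> Prop], and this copy of such a subset as a type lives in the lowest
    possible universe. *)
Record subcontinuum (A : set continuum) : Type :=
  SubContinuum { subcontinuum_val : nat -> Prop; subcontinuumP : A subcontinuum_val }.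

(** Transporting [L] to a small copy makes the hypothesis on [card_exp_lt]
    available for [L] in any universe. *)
Lemma power_le_continuum (L : Type) :
  [set: card_exp_lt continuum] #= [set: continuum] -> card_lt L continuum ->
  [set: set L] #<= [set: continuum].
Proof.
move=> h2c [/card_leT_inj[f finj] nCL].
pose g (l : L) : subcontinuum (range f) := SubContinuum _ _ (imageT f l).
have ginj : injective g by move=> l l' /(congr1 (subcontinuum_val _)) /finj.
have val_inj : injective (subcontinuum_val (range f)).
  by move=> [a pa] [b pb] /= e; subst b; rewrite (Prop_irrelevance pa pb).
have rc : card_lt (subcontinuum (range f)) continuum.
  split; first by apply/card_leT_inj; exists (subcontinuum_val _).
  move=> /card_le_trans h; apply: nCL; apply: h.
  pose l (s : subcontinuum (range f)) := projT1 (cid2 (subcontinuumP _ s)).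
  have fl s : f (l s) = subcontinuum_val _ s by rewrite /l; case: cid2.
  by apply/card_leT_inj; exists l => s t e; apply: val_inj; rewrite -!fl e.
have := (card_exp_ltP continuum).1 _ rc; rewrite (card_le_eqr h2c).
by apply: card_le_trans; apply/card_leT_inj; exists (image^~ g);
  exact: image_injective.
Qed.

(** [c^L = 2^(L * nat)], and [L * nat] is again smaller than [c]. *)
Lemma fun_to_continuum (L : Type) :
  [set: card_exp_lt continuum] #= [set: continuum] -> card_lt L continuum ->
  exists f : (L -> continuum) -> continuum, injective f.
Proof.
move=> h2c /card_lt_mul_nat LNc.
have /card_leT_inj[f finj] := power_le_continuum _ h2c LNc.
exists (fun s => f [set ln | s ln.1 ln.2]) => s t /finj e.
apply/funext => l; apply/funext => n.
exact: (congr1 (fun g : set (L * nat) => g (l, n)) e).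
Qed.

(** * Well-orders *)

Lemma wo_min {T : Type} {R : rel T} (wR : wochoice.well_order R) (P : set T) :
  P !=set0 -> exists z, P z /\ forall y, P y -> R z y.
Proof.
move=> [x Px]; have [|z [[zP zmin] _]] := wR (fun y => y \in P).
  by exists x; exact/mem_set.
by exists z; split=> [|y Py]; [exact: set_mem zP|apply: zmin; exact/mem_set].
Qed.

Lemma wo_refl {T : Type} {R : rel T} (wR : wochoice.well_order R) : reflexive R.
Proof.
by move=> x; have [|z [-> h]] := wo_min wR [set x]; [exists x|exact: h].
Qed.

Lemma wo_total {T : Type} {R : rel T} (wR : wochoice.well_order R) : total R.
Proof.
move=> x y; have [|z [zxy h]] := wo_min wR [set x; y]; first by exists x; left.
by case: zxy h => -> h; apply/orP; [left|right]; apply: h; [right|left].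
Qed.

Lemma wo_anti {T : Type} {R : rel T} (wR : wochoice.well_order R) x y :
  R x y -> R y x -> x = y.
Proof.
move=> xy yx; have [|z [_ zuniq]] := wR (fun u => u \in [set x; y]).
  by exists x; apply/mem_set; left.
have min u : u = x \/ u = y -> R u x -> R u y -> z = u.
  move=> uxy ux uy; apply: zuniq; split; first exact/mem_set.
  by move=> v /set_mem[|] ->.
by rewrite -[LHS]min; [apply: min| | |]; rewrite ?(wo_refl wR) //; [right|left].
Qed.

Lemma wo_trans {T : Type} {R : rel T} (wR : wochoice.well_order R) y x z :
  R x y -> R y z -> R x z.
Proof.
move=> xy yz.
have [|m [mxyz h]] := wo_min wR [set u | u = x \/ u = y \/ u = z].
  by exists x; left.
have [hx hy hz] : [/\ R m x, R m y & R m z] by split; apply: h => /=; tauto.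
case: mxyz => [e|[e|e]]; subst m; first by [].
  by rewrite (wo_anti wR _ _ xy hx).
by rewrite -(wo_anti wR _ _ yz hy).
Qed.

Lemma wo_ltW {T : Type} {R : rel T} (wR : wochoice.well_order R) x y :
  ~~ R y x -> R x y.
Proof. by have /orP[//|->] := wo_total wR x y. Qed.

Lemma wo_lt_le {T : Type} {R : rel T} (wR : wochoice.well_order R) y x z :
  ~~ R y x -> R y z -> ~~ R z x.
Proof. by move=> xy yz; apply: contra xy => /(wo_trans wR _ _ _ yz). Qed.

Lemma wo_wf {T : Type} {R : rel T} (wR : wochoice.well_order R) :
  well_founded (fun x y : T => ~~ R y x).
Proof.
set lt := fun x y => _; move=> a; apply: contrapT => na.
have [|z [nz h]] := wo_min wR [set u | ~ Acc lt u]; first by exists a.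
apply: nz; constructor => y yz; apply: contrapT => ny.
by move/negP: yz; apply; exact: h.
Qed.

(** Total functions stand for partial ones: [step a] may be given any function,
    but sees only its values strictly below [a]. *)
Lemma wo_rec {T Y : Type} {R : rel T} (wR : wochoice.well_order R) (y0 : Y)
    (step : T -> (T -> Y) -> Y) :
  (forall a f g, (forall c, ~~ R a c -> f c = g c) -> step a f = step a g) ->
  exists h : T -> Y, forall a, h a = step a h.
Proof.
move=> stepE.
pose ext a (f : forall c, ~~ R a c -> Y) c :=
  if pselect (~~ R a c) is left h then f c h else y0.
exists (Fix (wo_wf wR) (fun=> Y) (fun a f => step a (ext a f))) => a.
rewrite Fix_eq => [|b f g fg].
  by apply: stepE => c ac; rewrite /ext; case: pselect.
by apply: stepE => c bc; rewrite /ext; case: pselect.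
Qed.

Lemma wo_exists (T : Type) : exists R : rel T, wochoice.well_order R.
Proof.
by have [R wR] := wochoice.well_ordering_principle {classic T}; exists R.
Qed.

Lemma wo_sub {T : Type} {R : rel T} (wR : wochoice.well_order R) (S : set T) :
  wochoice.well_order (fun a b : set_type S => R (val a) (val b)).
Proof.
apply: wochoice.antisymmetric_well_order.
  by move=> a b /andP[ab ba]; apply: val_inj; exact: (wo_anti wR).
move=> A [a Aa]; have [|z [[b Ab <-] h]] := wo_min wR (val @` [set b | b \in A]).
  by exists (val a), a.
by exists b; split=> // c Ac; apply: h; exists c.
Qed.

(** * Discrete sets and the cardinals they bound *)

Lemma discrete_subsetP (X : topologicalType) (A : set X) :
  discrete_subset A <-> forall x, A x ->
    exists O, [/\ open O, O x & forall y, A y -> O y -> y = x].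
Proof.
split=> [dA x Ax|h U].
  pose a : set_type A := SigSub (mem_set Ax).
  have [O oO Oa] := dA [set a]; exists O; split=> //.
    by have : (val @^-1` O) a by rewrite [X in X a]Oa.
  move=> y Ay Oy; pose b : set_type A := SigSub (mem_set Ay).
  have : (val @^-1` O) b by [].
  by rewrite [X in X b]Oa => /(congr1 val).
pose f (a : set_type A) := projT1 (cid (h (val a) (set_mem (valP a)))).
have fP a : [/\ open (f a), f a (val a) & forall y, A y -> f a y -> y = val a].
  exact: (projT2 (cid (h (val a) (set_mem (valP a))))).
exists (\bigcup_(a in U) f a).
  by apply: bigcup_open => a _; have [] := fP a.
apply/seteqP; split=> [b [a Ua fab]|b Ub]; last by exists b; have [] := fP b.
have [_ _ /(_ _ (set_mem (valP b)) fab) /val_inj e] := fP a.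
by rewrite e.
Qed.

Lemma discrete_subsetS (X : topologicalType) (A B : set X) :
  A `<=` B -> discrete_subset B -> discrete_subset A.
Proof.
move=> AB /discrete_subsetP dB; apply/discrete_subsetP => x /AB /dB[O [oO Ox h]].
by exists O; split=> // y /AB; exact: h.
Qed.

(** If [D] had at least [|K|] points, it would have a subset of cardinality
    [s_hat X], discrete as a subset of [D]. *)
Lemma discrete_card_lt (X : topologicalType) (K : Type) (D : set X) :
  [set: s_hat X] #<= [set: K] -> discrete_subset D -> card_lt (set_type D) K.
Proof.
move=> sK dD; apply: contrapT => nlt.
have KD : [set: K] #<= [set: set_type D].
  apply: contrapT => nKD; apply: nlt; split=> //.
  by have [//|] := card_le_total K (set_type D).
have /card_leT_inj[f finj] := card_le_trans sK KD.
apply: ((s_hatP X).1 (range (val \o f))).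
  by apply: inj_card_eq => x y _ _ /val_inj; exact: finj.
by apply: discrete_subsetS dD => _ [s _ <-]; exact: set_mem (valP (f s)).
Qed.

(** Both factors of [s_hat X * b_card X] are nonzero when [X] is nonempty, so
    that a bound on the product bounds each of them: the empty set is discrete,
    and singletons are free sequences. *)
Lemma s_hat_inhabited (X : topologicalType) : exists s : s_hat X, True.
Proof.
apply: contrapT => ns; apply: ((s_hatP X).1 set0).
  suff -> : [set: s_hat X] = set0 by rewrite card_eq00.
  by apply/seteqP; split=> // s _; case: ns; exists s.
by apply/discrete_subsetP.
Qed.

Lemma b_card_inhabited (X : topologicalType) (x : X) : exists b : b_card X, True.
Proof.
have [R wR] := wo_exists unit.
have fx : free_sequence [set x].
  exists unit, R, (fun=> x); split.
    split=> // -[]; apply/seteqP; split=> // z [_ /(_ setT)].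
    case=> [|y [[[] ntt _] _]]; [exact: filterT|].
    by move: ntt; rewrite /= (wo_refl wR).
  by apply/seteqP; split=> [y [u _ <-]|y ->] //; exists tt.
have := (b_cardP X).1 _ fx; rewrite -(card_le_eql (card_setT _)).
move=> /card_leT_inj[f _].
by exists (f (SigSub (mem_set (subset_closure (erefl x : [set x] x))))).
Qed.

(** * Closed sets as intersections of few open sets *)

(** Shapirovskii's lemma.  Run through [X] along a well-order and put [y] in [D]
    when it is covered neither by the closure of the points already in [D] nor
    by their neighbourhoods.  The complement of the former separates [y] from
    the earlier points of [D], its own neighbourhood from the later ones. *)
Lemma discrete_cover (X : topologicalType) (Y : set X) (V : X -> set X) :
  (forall y, Y y -> open (V y) /\ V y y) ->
  exists D : set X, [/\ D `<=` Y, discrete_subset D &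
    Y `<=` closure D `|` \bigcup_(y in D) V y].
Proof.
move=> VP; have [R wR] := wo_exists X.
pose below (S : set X) y := [set z | S z /\ ~~ R y z].
pose covered (S : set X) y :=
  (closure (below S y) `|` \bigcup_(z in below S y) V z) y.
have [D DE] : exists D : set X, forall y, D y = (Y y /\ ~ covered D y).
  apply: (wo_rec wR True (fun y S => Y y /\ ~ covered S y)) => y S S' SS'.
  suff e : below S y = below S' y by rewrite /covered e.
  apply/funext => z; rewrite /below /=; apply/propext.
  by split=> -[Sz yz]; split=> //; move: Sz; rewrite SS'.
exists D; split=> [y|| y Yy].
- by rewrite DE => -[].
- apply/discrete_subsetP => y Dy.
  have [Yy /not_orP[ncl _]] : Y y /\ ~ covered D y by rewrite -DE.
  have [oV Vy] := VP _ Yy.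
  exists (V y `&` ~` closure (below D y)); split=> //.
    by apply: openI => //; apply: closed_openC; exact: closed_closure.
  move=> z Dz [Vz nz].
  have yz : R y z.
    by apply: contrapT => /negP yz; apply: nz; apply: subset_closure.
  apply: (wo_anti wR) => //; apply: contrapT => /negP zy.
  have [_ /not_orP[_ nV]] : Y z /\ ~ covered D z by rewrite -DE.
  by apply: nV; exists y.
- have [Dy|nDy] := pselect (D y); first by left; exact: subset_closure.
  have : covered D y.
    by apply: contrapT => nc; apply: nDy; rewrite DE.
  move=> [cl|[z [Dz _] Vz]]; last by right; exists z.
  by left; apply: closureS cl => z [].
Qed.

(** Cover the complement of [closure A] by open sets [V y] whose closures miss
    [closure A], and let [D] be the discrete set given by [discrete_cover].  A
    point [p] outside [closure A] lies in [V d] for some [d] in [D], or in the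
    closure of [D], and then in the closure of the part of [D] lying in [V p].
    So the complement is a union of closed sets, each given by an element or a
    subset of [D], and there are at most [2^|D|] of them. *)
Lemma closure_pseudocharacter (X : topologicalType) (K : Type) (A : set X) :
  regular_space X ->
  (forall D : set X, discrete_subset D -> [set: set (set_type D)] #<= [set: K]) ->
  exists W : K -> set X, (forall k, open (W k) /\ closure A `<=` W k) /\
    forall p, ~ closure A p -> exists k, ~ W k p.
Proof.
move=> hreg hK; set F := closure A.
have /choice[V VP] : forall y, exists Vy, ~ F y ->
    [/\ open Vy, Vy y & closure Vy `&` F = set0].
  move=> y; have [Fy|nFy] := pselect (F y); first by exists setT.
  have oF : open (~` F) by apply: closed_openC; exact: closed_closure.
  have [B nB BF] : filter_from (nbhs y) closure (~` F).
    by apply: hreg; apply: open_nbhs_nbhs.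
  move: nB; rewrite nbhsE => -[O [oO Oy] OB].
  exists O => _; split=> //; apply/seteqP; split=> // z [/(closureS OB)].
  by move=> /BF.
have [|D [DF dD cov]] := discrete_cover X (~` F) V.
  by move=> y /VP[].
have /card_leT_inj[f finj] := hK D dD.
(* A singleton [set d] stands for the neighbourhood V d of d. *)
pose Z (E : set (set_type D)) :=
  closure (val @` E `|` \bigcup_(d in [set d | E = [set d]]) V (val d)).
pose W k := \bigcap_(E in [set E | f E = k /\ Z E `&` F = set0]) ~` Z E.
have WE E : Z E `&` F = set0 -> W (f E) = ~` Z E.
  move=> ZF; apply/seteqP; split=> [p|p nZ E' [/finj ->//]].
  by apply; split.
have Z1 d : Z [set d] = closure (V (val d)).
  have [_ Vd _] := VP _ (DF _ (set_mem (valP d))).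
  congr closure; apply/seteqP; split=> [z|z Vz].
    move=> [[_ -> <-]//|[d' /= e]].
    by have -> : d' = d by have : [set d] d' by rewrite e.
  by right; exists d.
exists W; split=> [k|p nFp].
  have [[E [<- ZF]]|nE] := pselect (exists E, f E = k /\ Z E `&` F = set0).
    rewrite WE //; split; first by apply: closed_openC; exact: closed_closure.
    by move=> z Fz Zz; have : (Z E `&` F) z by []; rewrite ZF.
  have -> : W k = setT.
    by apply/seteqP; split=> // z _ E hE; case: nE; exists E.
  by split; [exact: openT|].
suff [E [Zp ZF]] : exists E, Z E p /\ Z E `&` F = set0.
  by exists (f E); rewrite WE //; exact.
have [clD|[d Dd Vdp]] := cov p nFp; last first.
  exists [set SigSub (mem_set Dd)]; rewrite Z1 /=.
  by have [_ _ ->] := VP _ (DF _ Dd); split=> //; exact: subset_closure.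
have [oV Vp VF] := VP _ nFp.
pose E : set (set_type D) := [set d | V p (val d)].
have clE : closure (val @` E) p.
  move=> B nB; have [|d [Dd [Vd Bd]]] := clD (V p `&` B).
    by apply: filterI => //; exact: open_nbhs_nbhs.
  by exists d; split=> //; exists (SigSub (mem_set Dd)).
exists E; split; first by apply: closureS clE; exact: subsetUl.
have [[d Ed]|nd] := pselect (exists d, E = [set d]).
  by rewrite Ed Z1; have [] := VP _ (DF _ (set_mem (valP d))).
apply/seteqP; split=> // z [Zz Fz].
suff : (closure (V p) `&` F) z by rewrite VF.
split=> //; apply: closureS Zz => y [[d Ed <-]//|[d Ed _]].
by case: nd; exists d.
Qed.

(** * Separated transfinite sequences *)

(** For each [g] some open set contains the closure of the terms up to [g] and
    misses the later ones: it is [V s] for the successor [s] of [g], and the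
    whole space when [g] is the last index.  This is freeness.  Removing from
    that set the closure of the terms before [g], which misses [x g] because
    [V g] does, isolates [x g]. *)
Lemma separated_sequence (X : topologicalType) (I : Type) (R : rel I)
    (x : I -> X) (V : I -> set X) :
  wochoice.well_order R ->
  (forall b, open (V b)) ->
  (forall b, closure (x @` [set c | ~~ R b c]) `<=` V b) ->
  (forall b c, R b c -> ~ V b (x c)) ->
  [/\ free_enumeration R x, injective x & discrete_subset (range x)].
Proof.
move=> wR oV clV xV.
have cut g : exists O, [/\ open O, closure (x @` [set c | R c g]) `<=` O &
    forall c, ~~ R c g -> ~ O (x c)].
  have [[c0 gc0]|nc] := pselect (exists c, ~~ R c g); last first.
    exists setT; split=> //; first exact: openT.
    by move=> c gc; case: nc; exists c.
  have [|s [gs smin]] := wo_min wR [set c | ~~ R c g]; first by exists c0.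
  exists (V s); split=> // [|c gc]; last by apply: xV; exact: smin.
  apply: subset_trans (clV s); apply: closureS.
  move=> _ [c cg <-]; exists c => //.
  by apply: contra gs => sc; exact: (wo_trans wR) cg.
have inj_lt c d : ~~ R d c -> x c <> x d.
  move=> cd e; apply: (xV d d); first exact: (wo_refl wR).
  by apply: clV; apply: subset_closure; exists c.
have xinj : injective x.
  move=> c d e; apply: (wo_anti wR); apply: contrapT => /negP.
    by move=> /inj_lt; apply.
  by move=> /inj_lt; apply.
split=> //.
  split=> // g; apply/seteqP; split=> // z [zle zgt].
  have [O [oO clO xO]] := cut g.
  have [|_ [[c gc <-] Oc]] := zgt O; last exact: (xO c).
  by apply: open_nbhs_nbhs; split=> //; exact: clO.
apply/discrete_subsetP => _ [g _ <-]; have [O [oO clO xO]] := cut g.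
exists (O `&` ~` closure (x @` [set c | ~~ R g c])); split.
- by apply: openI => //; apply: closed_openC; exact: closed_closure.
- split.
    apply: clO; apply: subset_closure; exists g => //=; exact: (wo_refl wR).
  by move=> /clV; apply: xV; exact: (wo_refl wR).
- move=> _ [c _ <-] [Oc nc]; congr x; apply: (wo_anti wR); apply: contrapT => /negP.
    by move=> gc; exact: (xO c).
  by move=> cg; apply: nc; apply: subset_closure; exists c.
Qed.

(** The same along an initial segment [S] of a longer well-order; [S] is the set
    of stages before the construction stops. *)
Lemma separated_segment (X : topologicalType) (T : Type) (R : rel T)
    (S : set T) (x : T -> X) (V : T -> set X) :
  wochoice.well_order R ->
  (forall b c, S b -> ~~ R b c -> S c) ->
  (forall b, S b -> open (V b)) ->
  (forall b, S b -> closure (x @` [set c | ~~ R b c]) `<=` V b) ->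
  (forall b c, S b -> S c -> R b c -> ~ V b (x c)) ->
  [/\ free_sequence (x @` S), set_inj S x & discrete_subset (x @` S)].
Proof.
move=> wR Sdown oV clV xV.
have inS (b : set_type S) : S (val b) := set_mem (valP b).
have [b|b|b c|fr xinj dx] := separated_sequence X (set_type S)
  (fun a b => R (val a) (val b)) (fun b => x (val b)) (fun b => V (val b))
  (wo_sub wR S).
- exact/oV.
- apply: subset_trans (clV _ (inS b)); apply: closureS.
  by move=> _ [c bc <-]; exists (val c).
- exact: xV.
have <- : range (fun b : set_type S => x (val b)) = x @` S.
  apply/seteqP; split=> [_ [b _ <-]|_ [b Sb <-]]; first by exists (val b).
  by exists (SigSub (mem_set Sb)).
split=> //.
  by exists (set_type S), (fun a b => R (val a) (val b)), (fun b => x (val b)).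
move=> b c /set_mem Sb /set_mem Sc e.
exact: (congr1 val (xinj (SigSub (mem_set Sb)) (SigSub (mem_set Sc)) e)).
Qed.

(** * The tree of free sequences *)

(** The point chosen depends only on the set to be avoided; hence sequences
    obtained from different [G] agree as long as the values of [G] that they
    meet agree.  The default [x0] is reached only when no point remains. *)
Lemma avoiding_sequence (X : choiceType) (T : Type) (R : rel T) (x0 : X)
    (G : set X -> set X) : wochoice.well_order R ->
  exists x : T -> X, forall a, x a =
    xget x0 (~` \bigcup_(b in [set b | R b a]) G (x @` [set c | ~~ R b c])).
Proof.
move=> wR.
apply: (wo_rec wR x0 (fun a f => xget x0
  (~` \bigcup_(b in [set b | R b a]) G (f @` [set c | ~~ R b c])))).
move=> a f g fg; congr (xget _ (~` _)); apply: eq_bigcupr => b ba.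
congr G; apply: eq_imagel => c bc; apply: fg.
exact: (wo_lt_le wR _ _ _ bc).
Qed.

Theorem theorem3p12
  (h2c : [set: card_exp_lt continuum] #= [set: continuum])
  (X : topologicalType) (hreg : regular_space X) (hT2 : hausdorff_space X)
  (hX : [set: (s_hat X * b_card X)%type] #<= [set: continuum]) :
  [set: X] #<= [set: continuum].
Proof.
have [[x0 _]|nX] := pselect (exists x : X, True); last first.
  apply/card_leT_inj; exists (fun=> set0 : continuum) => p.
  by case: nX; exists p.
have [s0 _] := s_hat_inhabited X; have [b0 _] := b_card_inhabited X x0.
have /card_leT_inj[h hinj] := hX.
have sX : [set: s_hat X] #<= [set: continuum].
  by apply/card_leT_inj; exists (fun s => h (s, b0)) => s t /hinj[].
have bX : [set: b_card X] #<= [set: continuum].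
  by apply/card_leT_inj; exists (fun b => h (s0, b)) => b c /hinj[].
have discX (D : set X) : discrete_subset D -> card_lt (set_type D) continuum.
  exact: discrete_card_lt.
have clX (F : set X) : free_sequence F -> closure F #<= [set: continuum].
  by move=> /(b_cardP X).1 /card_le_trans; apply.
have /choice[W WP] : forall A, exists W : continuum -> set X,
    (forall k, open (W k) /\ closure A `<=` W k) /\
    forall p, ~ closure A p -> exists k, ~ W k p.
  move=> A; apply: closure_pseudocharacter => // D /discX Dc.
  exact: power_le_continuum.
have /choice[idx idxP] : forall p, exists idx : set X -> continuum,
    forall A, ~ closure A p -> ~ W A (idx A) p.
  move=> p; suff /choice[f fP] : forall A, exists k, ~ closure A p -> ~ W A k p.
    by exists f.
  move=> A; have [clp|nclp] := pselect (closure A p); first by exists set0.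
  by have [k] := (WP A).2 p nclp; exists k.
have [R wR] := wo_exists continuum.
pose seg a := [set c | ~~ R a c].
have /choice[x xE] : forall p, exists x : continuum -> X, forall a, x a =
    xget x0 (~` \bigcup_(b in [set b | R b a])
                   W (x @` seg b) (idx p (x @` seg b))).
  by move=> p; exact: (avoiding_sequence _ _ _ x0 (fun A => W A (idx p A)) wR).
have good p (S : set continuum) :
    (forall b c, S b -> R c b -> S c) ->
    (forall b, S b -> ~ closure (x p @` seg b) p) ->
    [/\ free_sequence (x p @` S), card_lt (set_type S) continuum
      & closure (x p @` S) #<= [set: continuum]].
  move=> Sdown Sp.
  have [b c Sb bc|b _|b _|b c Sb Sc bc|fr xinj /discX dx] :=
    separated_segment _ _ _ S (x p)
      (fun b => W (x p @` seg b) (idx p (x p @` seg b))) wR.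
  - by apply: (Sdown b) => //; exact: (wo_ltW wR).
  - by have [] := (WP (x p @` seg b)).1 (idx p (x p @` seg b)).
  - by have [] := (WP (x p @` seg b)).1 (idx p (x p @` seg b)).
  (* p lies outside the open sets of all stages up to c, so the set from which
     x p c is chosen is nonempty. *)
  - move=> Wc.
    suff : (~` \bigcup_(b in [set b | R b c])
                   W (x p @` seg b) (idx p (x p @` seg b))) (x p c).
      by apply; exists b.
    rewrite [X in _ X]xE; apply: (xgetPex x0); exists p => -[d dc].
    by apply: idxP; apply: Sp; exact: (Sdown c).
  - split=> //; last exact: clX.
    by apply: card_lt_eql dx; exact: inj_card_eq.
have stop p : exists a, closure (x p @` seg a) p /\
    forall b, ~~ R a b -> ~ closure (x p @` seg b) p.
  have [[b bp]|nb] := pselect (exists b, closure (x p @` seg b) p).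
    have [|a [ap amin]] := wo_min wR [set b | closure (x p @` seg b) p].
      by exists b.
    by exists a; split=> // c ac /amin; exact/negP.
  (* Otherwise the whole continuum would index a discrete set. *)
  have [||_ [_]] := good p setT; [by []|by move=> b _ bp; apply: nb; exists b|].
  by rewrite (card_le_eqr (card_setT _)) card_leT.
have /choice[stage stageP] := stop.
have goodseg p : [/\ free_sequence (x p @` seg (stage p)),
    card_lt (set_type (seg (stage p))) continuum
  & closure (x p @` seg (stage p)) #<= [set: continuum]].
  have [_ stP] := stageP p; apply: good => // b c bc cb.
  by apply: contra bc => sc; exact: (wo_trans wR) cb.
have codeP a : exists e : (set_type (seg a) -> continuum) -> continuum,
    card_lt (set_type (seg a)) continuum -> injective e.
  have [/(fun_to_continuum _ h2c)[e einj]|] :=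
    pselect (card_lt (set_type (seg a)) continuum); first by exists e.
  by exists (fun=> set0).
pose code a := projT1 (cid (codeP a)).
have codeI a : card_lt (set_type (seg a)) continuum -> injective (code a).
  exact: (projT2 (cid (codeP a))).
have /choice[j jP] : forall F : set X, exists j : X -> continuum,
    closure F #<= [set: continuum] -> set_inj (closure F) j.
  move=> F; have [|] := pselect (closure F #<= [set: continuum]); last first.
    by exists (fun=> set0).
  by move=> /(card_le_set_inj _ _ (set0 : continuum))[f finj]; exists f.
have [pr prI] := continuum_pairing.
pose choices p (b : set_type (seg (stage p))) :=
  idx p (x p @` seg (val b)).
apply/card_leT_inj; exists (fun p => pr (pr (stage p, code _ (choices p)),
  j (x p @` seg (stage p)) p)) => p q /prI[/prI[]].
rewrite /choices.
have [_ sp cp] := goodseg p.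
have [clp _] := stageP p; have [clq _] := stageP q.
move: sp cp clp clq; move: (stage p) (stage q) => a a' + + + + e.
case: a' / e => sp cp clp clq /(codeI _ sp) ce.
(* Equal indices below a force equal terms below a, by induction. *)
have xe c : ~~ R a c -> x p c = x q c.
  elim/(well_founded_ind (wo_wf wR)): c => c IH ac.
  rewrite !xE; congr (xget _ (~` _)); apply: eq_bigcupr => b bc.
  have ab : seg a b by apply: contra ac => ab; exact: (wo_trans wR) bc.
  congr W; last exact: (congr1 (fun s => s (SigSub (mem_set ab))) ce).
    apply: eq_imagel => d bd; apply: IH.
      exact: (wo_lt_le wR _ _ _ bd).
    by apply: contra bd => ad; exact: (wo_trans wR) (wo_ltW wR _ _ ab) ad.
have pq : x q @` seg a = x p @` seg a by apply: eq_imagel => c ac; rewrite xe.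
by rewrite pq in clq *; apply: jP => //; exact: mem_set.
Qed.
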